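(* Let $d \geq 2$ and $k \in \mathbb{N}$ be constants. The query complexity of finding a local minimum of a function $f:[n]^d \to \mathbb{R}$ on the $d$-dimensional grid $[n]^d$ with at most $k$ rounds of queries is $\Theta\bigl(n^{\frac{d^{k+1} - d^k}{d^k - 1}}\bigr)$ (as $n \to \infty$), both for deterministic algorithms and for randomized algorithms.
   Context: $[n] = \{1,\dots,n\}$. The grid $[n]^d$ is the graph with vertex set $[n]^d$ in which $\vec{x},\vec{y}$ are adjacent iff $\|\vec{x}-\vec{y}\|_1 = 1$. A local minimum of $f$ is a vertex $\vec{x}$ with $f(\vec{x}) \leq f(\vec{y})$ for all neighbours $\vec{y}$ of $\vec{x}$. The algorithm has oracle access to $f$ (a query at $\vec{x}$ returns $f(\vec{x})$). In a $k$-round algorithm, in each round $j \le k$ the algorithm submits a set of queries chosen as a function of the answers from rounds $1,\dots,j-1$ (and its random coins, if randomized), then receives all answers; after round $k$ it must output a solution. The deterministic query complexity is the worst-case total number of queries needed to always output a correct solution. The randomized query complexity is the (worst-case over inputs) expected number of queries of an algorithm that outputs a correct solution with probability at least $2/3$ on every input, the expectation and probability being over the algorithm's coins. *)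

(* Defs.v *)
From HB Require Import structures.
From mathcomp Require Import all_boot all_order all_algebra.
From mathcomp Require Import all_classical all_reals all_analysis.

Set Implicit Arguments.
Unset Strict Implicit.
Unset Printing Implicit Defensive.

Import Order.TTheory GRing.Theory Num.Theory.
Import numFieldNormedType.Exports.

Local Open Scope classical_set_scope.
Local Open Scope ring_scope.

(* Coordinates range over {0, ..., n-1} instead of {1, ..., n}. *)
Definition grid (d n : nat) := {ffun 'I_d -> 'I_n}.

(* [`|x i - y i|%N] is the distance between two naturals (computed in [int]),
   not truncated subtraction. *)
Definition l1_dist (d n : nat) (x y : grid d n) : nat :=
  (\sum_(i < d) `|x i - y i|)%N.

Definition adjacent (d n : nat) (x y : grid d n) : bool := l1_dist x y == 1%N.

Definition local_min (R : realType) (d n : nat) (f : grid d n -> R)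
    (x : grid d n) : Prop :=
  forall y : grid d n, adjacent x y -> f x <= f y.

(* A deterministic algorithm with [k] rounds, as a decision tree: [Round Q next]
   submits the set [Q] and, given the answers on [Q] only, goes on with an
   algorithm for the remaining rounds. As [Q] may be empty, this also covers
   algorithms that use fewer than [k] rounds. The output need not have been
   queried. *)
Inductive algorithm (R : realType) (d n : nat) : nat -> Type :=
| Output of grid d n : algorithm R d n 0
| Round k (Q : {set grid d n})
    (next : {ffun {x : grid d n | x \in Q} -> R} -> algorithm R d n k) :
    algorithm R d n k.+1.

Fixpoint output (R : realType) (d n k : nat) (A : algorithm R d n k)
    (f : grid d n -> R) : grid d n :=
  match A with
  | Output x => x
  | Round _ _ next => output (next [ffun x => f (val x)]) f
  end.

Fixpoint num_queries (R : realType) (d n k : nat) (A : algorithm R d n k)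
    (f : grid d n -> R) : nat :=
  match A with
  | Output _ => 0
  | Round _ Q next => #|Q| + num_queries (next [ffun x => f (val x)]) f
  end%N.

Definition correct (R : realType) (d n k : nat) (A : algorithm R d n k) : Prop :=
  forall f : grid d n -> R, local_min f (output A f).

Definition worst_case_queries (R : realType) (d n k : nat)
    (A : algorithm R d n k) : \bar R :=
  ereal_sup [set ((num_queries A f)%:R)%:E | f in [set: grid d n -> R]].

Definition deterministic_complexity (R : realType) (d k n : nat) : \bar R :=
  ereal_inf [set c | exists2 A : algorithm R d n k,
             correct A & worst_case_queries A = c].

(* All the coins are drawn beforehand, from an arbitrary probability space; each
   outcome fixes a deterministic algorithm. On every input, the number of
   queries and the output must be random variables. *)
Record randomized_algorithm (R : realType) (d n k : nat) := RandomizedAlgorithm {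
  coins_display : measure_display ;
  coins : measurableType coins_display ;
  coins_law : probability coins R ;
  play : coins -> algorithm R d n k ;
  measurable_num_queries : forall f : grid d n -> R,
    measurable_fun [set: coins] (fun w => num_queries (play w) f) ;
  measurable_output : forall (f : grid d n -> R) (x : grid d n),
    measurable [set w | output (play w) f = x]
}.

Definition randomized_correct (R : realType) (d n k : nat)
    (A : randomized_algorithm R d n k) : Prop :=
  forall f : grid d n -> R,
    ((2 / 3)%:E <= coins_law A [set w | local_min f (output (play w) f)])%E.

Definition expected_queries (R : realType) (d n k : nat)
    (A : randomized_algorithm R d n k) (f : grid d n -> R) : \bar R :=
  ('E_(coins_law A)[fun w => (num_queries (play w) f)%:R])%E.

Definition worst_case_expected_queries (R : realType) (d n k : nat)
    (A : randomized_algorithm R d n k) : \bar R :=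
  ereal_sup [set expected_queries A f | f in [set: grid d n -> R]].

Definition randomized_complexity (R : realType) (d k n : nat) : \bar R :=
  ereal_inf [set c | exists2 A : randomized_algorithm R d n k,
             randomized_correct A & worst_case_expected_queries A = c].

(* Main.v *)
(* Upper bound: query a lattice of axis-parallel walls of mesh l inside the
   current region and move to the best queried point p; the walls next to p
   bound a region of side 2l none of whose outer neighbours is better than p, so
   it contains a local minimum of the whole grid.  The meshes l_0 = n, l_1, ...,
   l_k = 1 with l_i ~ n^((d^k - d^i)/(d^k - 1)) make every round cost
   l_i^d / l_(i+1) ~ n^rate.

   Lower bound (Yao's principle): the input is minus the l1 norm along a monotone
   path from the origin and the l1 norm elsewhere, so that the end of the path is
   the only local minimum.  The path is a concatenation of k+1 segments with
   independent uniform displacements, the i-th one (from 0) in a cube of side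
   ~ l_i.  As long as round j does not hit the path after segment j, the algorithm
   behaves as on the path truncated there; given the segments before segment j,
   the points after segment j are spread by the j-th displacement over l_j^d
   positions, and there are only O(l_(j+1)) of them, so each query hits with
   probability O(l_(j+1) / l_j^d) = O(n^(-rate)).  The expected number of
   queries is bounded on every input, in particular on the truncated paths, so
   the hitting probabilities may be summed without truncating the algorithm. *)

Require Import Defs.
From HB Require Import structures.
From mathcomp Require Import all_boot all_order all_algebra.
From mathcomp Require Import all_classical all_reals all_analysis measurable_realfun.
From mathcomp Require Import zify ring lra.
Set Implicit Arguments.
Unset Strict Implicit.
Unset Printing Implicit Defensive.
Import Order.TTheory GRing.Theory Num.Theory.
Import numFieldNormedType.Exports.
Local Open Scope ring_scope.


(** * The descent algorithm *)

Section UpperBound.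
Variables (R : realType) (d n : nat).
Local Notation point := (grid d n).
Local Notation adjacent := Defs.adjacent.
Implicit Types (B Q : {set point}) (p x y : point) (f : point -> R).

(** The incumbent [p] is included so that the best value never increases and the minimum ranges over
    a non-empty set. *)
Definition separators (l : nat) B p : {set point} :=
  p |: [set x in B | [exists c, l %| x c]]%N.

(* On every axis, the multiples of [l] next to [p c] on either side, [p c]
   itself excluded, bound an open interval; the cell is their product. *)
Definition cell (l : nat) p : {set point} :=
  [set y : point | [forall c, ((p c + l.-1) %/ l * l < y c + l) &&
                      (y c < (p c %/ l).+1 * l)]]%N.

Definition extend Q (a : {ffun {x : point | x \in Q} -> R}) x : R :=
  if insub x is Some u then a u else 0.

Definition argmin_on Q p (a : {ffun {x : point | x \in Q} -> R}) : point :=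
  [arg min_(x < p | x \in Q) extend a x]%O.

(** The mesh is indexed by the number of rounds left after the current one, so the last round has
    mesh [l 0]. *)
Fixpoint descent (l : nat -> nat) (k : nat) B p : algorithm R d n k :=
  if k is k'.+1 then
    Round (fun a : {ffun {x : point | x \in separators (l k') B p} -> R} =>
      let p' := argmin_on p a in descent l k' (B :&: cell (l k') p') p')
  else Output R p.

(** Invariant of the descent; once [B] has shrunk to the single point [p], it is local
    minimality. *)
Definition barrier B p f :=
  p \in B /\ forall x y, x \in B -> y \notin B -> adjacent x y -> f p <= f y.

Lemma extend_restrict Q f x :
  x \in Q -> extend [ffun u : {x : point | x \in Q} => f (val u)] x = f x.
Proof. by move=> xQ; rewrite /extend insubT /= ffunE. Qed.

Lemma argmin_onP Q p f (q := argmin_on p [ffun u : {x | x \in Q} => f (val u)]) :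
  p \in Q -> q \in Q /\ {in Q, forall x, f q <= f x}.
Proof.
rewrite /q /argmin_on => pQ; case: arg_minP => //= i iQ imin.
by split => // x xQ; have := imin x xQ; rewrite !extend_restrict.
Qed.

Lemma adjacent_coord x y (c : 'I_d) : adjacent x y ->
  (x c <= (y c).+1 /\ y c <= (x c).+1)%N.
Proof.
move=> /eqP; rewrite /l1_dist (bigD1 c) //=; lia.
Qed.

Lemma mem_cell l p : (0 < l)%N -> p \in cell l p.
Proof.
move=> l0; rewrite inE; apply/forallP => c.
have := leq_trunc_div (p c + l.-1) l; have := ltn_ceil (p c) l0.
by move=> -> H /=; rewrite andbT; apply: leq_ltn_trans H _; lia.
Qed.

(** A unit step changes a coordinate by at most one, so leaving the open interval of an axis lands
    on an excluded endpoint. *)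
Lemma cell_boundary l p x y c : (0 < l)%N -> x \in cell l p -> adjacent x y ->
  ~~ (((p c + l.-1) %/ l * l < y c + l) && (y c < (p c %/ l).+1 * l))%N ->
  (l %| y c)%N.
Proof.
move=> l0; rewrite inE => /forallP /(_ c) /andP[x1 x2] /(adjacent_coord c)[a1 a2].
rewrite negb_and -!leqNgt => /orP[h|h].
  have -> : (y c : nat) = (((p c + l.-1) %/ l).-1 * l)%N by nia.
  exact: dvdn_mull.
have -> : (y c : nat) = ((p c %/ l).+1 * l)%N by lia.
exact: dvdn_mull.
Qed.

Lemma cell1 p : cell 1 p = [set p]%SET.
Proof.
apply/setP => y; rewrite !inE; apply/forallP/eqP => [h|-> c]; last first.
  by rewrite !divn1; lia.
by apply/ffunP => c; apply: val_inj; have := h c; rewrite !divn1 /=; lia.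
Qed.

(** An edge leaving the new region either leaves [B], where the old barrier applies and [p] is among
    the queries, or leaves the cell inside [B] and lands on a queried wall. *)
Lemma barrier_step l B p f : (0 < l)%N -> barrier B p f ->
  let p' := argmin_on p
    [ffun u : {x | x \in separators l B p} => f (val u)] in
  barrier (B :&: cell l p') p' f.
Proof.
move=> l0 [pB bar] p'.
have [p'Q p'min] : p' \in separators l B p /\
    {in separators l B p, forall x, f p' <= f x}.
  by apply: argmin_onP; rewrite !inE eqxx.
split.
  rewrite inE mem_cell // andbT; move: p'Q; rewrite !inE.
  by case/orP => [/eqP->|/andP[]].
move=> x y; rewrite !finset.in_setI => /andP[xB xc].
have [yB /= ync adj|yB _ adj] := boolP (y \in B); last first.
  by rewrite (le_trans _ (bar x y xB yB adj)) // p'min // !inE eqxx.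
apply: p'min; rewrite !inE yB /=; apply/orP; right.
move: ync; rewrite inE negb_forall => /existsP[c cy].
by apply/existsP; exists c; exact: (cell_boundary l0 xc adj cy).
Qed.

(** The last round has mesh 1, whose cells are single points; the premise on [k = 0] carries this
    through the induction. *)
Lemma descent_correct l k B p f : (forall j, (0 < l j)%N) -> l 0%N = 1%N ->
  barrier B p f -> (k = 0%N -> B \subset [set p]%SET) ->
  local_min f (output (descent l k B p) f).
Proof.
move=> l0 l01; elim: k B p => [|k IH] B p bar Bp /=.
  move=> y adj; have [pB /(_ p y pB) fpy] := bar; apply: fpy => //.
  apply/negP => yB; have := fintype.subsetP (Bp erefl) _ yB.
  rewrite inE => /eqP yp; move: adj; rewrite yp /adjacent /l1_dist.
  by rewrite big1 // => i _; rewrite distnn.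
apply: IH; first exact: barrier_step.
by move=> ->; rewrite l01 cell1 finset.subsetIr.
Qed.

(** * Query count of the descent *)

Definition in_cube (s : nat) B :=
  exists a : 'I_d -> nat, {in B, forall x : point, forall c, (a c <= x c < a c + s)%N}.

(** The extreme case is [l] dividing [p c]: the walls then lie at distance [l] on both sides, hence
    the factor 2. *)
Lemma cell_in_cube l p : (0 < l)%N -> in_cube (2 * l) (cell l p).
Proof.
move=> l0; exists (fun c => (p c).+1 - l)%N => x; rewrite inE => /forallP xc c.
have /andP[x1 x2] := xc c.
have := leq_trunc_div (p c) l.
have : (p c <= (p c + l.-1) %/ l * l)%N by have := ltn_ceil (p c + l.-1) l0; lia.
nia.
Qed.

Lemma card_ord_inj_lt (P : pred 'I_n) (g : 'I_n -> nat) (s : nat) :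
  {in P &, injective g} -> {in P, forall v, (g v < s)%N} -> (#|P| <= s)%N.
Proof.
move=> ginj gs; rewrite cardE -(size_map g) -[leqRHS](size_iota 0).
apply: uniq_leq_size => [|_ /mapP[v vP ->]].
  by rewrite map_inj_in_uniq ?enum_uniq // => u v; rewrite !mem_enum; apply: ginj.
by rewrite mem_iota /= gs // -mem_enum.
Qed.

Lemma card_interval (a s : nat) : (#|[pred v : 'I_n | a <= v < a + s]| <= s)%N.
Proof.
apply: (@card_ord_inj_lt _ (fun v => v - a)%N) => [u v|v]; rewrite !inE; last lia.
by move=> u1 v1 uv; apply: val_inj => /=; lia.
Qed.

(** Multiples are told apart by their quotients, which exceed [a %/ l] by at most [s %/ l + 1]. *)
Lemma card_multiples (l a s : nat) : (0 < l)%N ->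
  (#|[pred v : 'I_n | (a <= v < a + s) && (l %| v)]| <= s %/ l + 2)%N.
Proof.
move=> l0; apply: (@card_ord_inj_lt _ (fun v => v %/ l - a %/ l)%N) => [u v|v].
  rewrite !inE => /andP[/andP[u1 _] lu] /andP[/andP[v1 _] lv] uv.
  have := leq_div2r l u1; have := leq_div2r l v1 => v2 u2.
  by apply: val_inj => /=; rewrite -(divnK lu) -(divnK lv); congr (_ * _)%N; lia.
rewrite inE => /andP[/andP[v1 v2] _].
have : (v <= a + s)%N by lia.
move=> /(leq_div2r l) v3.
have := leq_divDl l a s; move: v3 => /=.
by move: (v %/ l)%N ((a + s) %/ l)%N (a %/ l)%N (s %/ l)%N; lia.
Qed.

Lemma card_box (P : 'I_d -> pred 'I_n) :
  #|[pred x : point | [forall c, P c (x c)]]| = (\prod_c #|P c|)%N.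
Proof.
transitivity #|family P|; first by apply: eq_card => x; rewrite !inE.
by rewrite card_family foldrE big_image.
Qed.

(** Union bound over the axis carrying the multiple of [l], the other [d.-1] coordinates being free;
    the final 1 pays for [p]. *)
Lemma card_separators (l s : nat) B p : (0 < l)%N -> in_cube s B ->
  (#|separators l B p| <= d * ((s %/ l + 2) * s ^ d.-1) + 1)%N.
Proof.
move=> l0 [a aB]; rewrite addnC cardsU1 leq_add ?leq_b1 //.
pose P (c0 c : 'I_d) : pred 'I_n :=
  [pred v : 'I_n | (a c <= v < a c + s) && ((c == c0) ==> (l %| v))]%N.
pose S (c : 'I_d) : {set point} := [set x : point | [forall c', P c c' (x c')]].
have sub : [set x in B | [exists c, l %| x c]%N] \subset \bigcup_c S c.
  apply/fintype.subsetP => x; rewrite inE => /andP[xB /existsP[c lc]].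
  apply/bigcupP; exists c => //; rewrite inE; apply/forallP => c'.
  by rewrite /P /= aB //=; apply/implyP => /eqP->.
apply: (leq_trans (subset_leq_card sub)).
have leU (F : 'I_d -> {set point}) : (#|\bigcup_c F c| <= \sum_c #|F c|)%N.
  elim/big_rec2: _ => [|c m A _ IH]; first by rewrite cards0.
  by rewrite (leq_trans (leq_card_setU _ _).1) // leq_add2l.
apply: (leq_trans (leU _)).
apply: (@leq_trans (\sum_(c < d) (s %/ l + 2) * s ^ d.-1)); last first.
  by rewrite sum_nat_const card_ord.
apply: leq_sum => c _; rewrite cardsE card_box (bigD1 c) //= leq_mul //.
  apply: leq_trans (card_multiples (a c) s l0).
  by apply: subset_leq_card; apply/fintype.subsetP => v; rewrite !inE /P /= eqxx.
apply: (@leq_trans (\prod_(i < d | i != c) s)).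
  apply: leq_prod => i ic; apply: leq_trans (card_interval (a i) s).
  apply: subset_leq_card; apply/fintype.subsetP => v.
  by rewrite !inE /P /= (negbTE ic) andbT.
by rewrite prod_nat_const cardC1 card_ord.
Qed.

(** [s j] is the side of the region with [j] rounds left: the initial side [s k] is free, the later
    ones come from [cell_in_cube]. *)
Lemma num_queries_descent l s k B p f : (forall j, (0 < l j)%N) ->
  in_cube (s k) B -> (forall j, (j < k)%N -> s j = 2 * l j)%N ->
  (num_queries (descent l k B p) f <=
   \sum_(j < k) (d * ((s j.+1 %/ l j + 2) * s j.+1 ^ d.-1) + 1))%N.
Proof.
move=> l0; elim: k B p => [|k IH] B p Bs sl //=.
rewrite big_ord_recr /= addnC leq_add ?card_separators //.
apply: IH => [|j jk]; last by apply: sl; lia.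
have [a ain] := cell_in_cube (argmin_on p
    [ffun u : {x | x \in separators (l k) B p} => f (val u)]) (l0 k).
exists a => x; rewrite inE => /andP[_ xc] c.
by rewrite sl // ain.
Qed.
End UpperBound.

(** * Path functions *)

Section PathFunctions.
Variables (R : realType) (d n : nat).
Local Notation point := (grid d n).
Local Notation adjacent := Defs.adjacent.
Implicit Types (w u v : seq 'I_d) (x y : point).

(* A word lists the axes of the successive unit steps of a monotone path from
   the origin, so that prefixes of the word are vertices of the path. *)
Definition weight x : nat := (\sum_c x c)%N.

Definition ends_at w x : bool := [forall c, x c == count_mem c w :> nat].

(** Each step adds one to the weight, so only the prefix of length [weight x] can end at [x]. *)
Definition on_path w x : bool := ends_at (take (weight x) w) x.

Definition path_fun w x : R :=
  if on_path w x then - (weight x)%:R else (weight x)%:R.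

Lemma sum_count_mem w : (\sum_c count_mem c w)%N = size w.
Proof.
elim: w => [|a w IH] /=; first by rewrite big1.
rewrite big_split /= IH (bigD1 a) //= eqxx big1 ?addn0 // => i /negbTE.
by rewrite eq_sym => ->.
Qed.

Lemma ends_at_weight w x : ends_at w x -> weight x = size w.
Proof. by move=> /forallP e; rewrite -sum_count_mem; apply: eq_bigr => c _; apply/eqP. Qed.

Lemma on_path_weight w x : on_path w x -> (weight x <= size w)%N.
Proof. by move/ends_at_weight => ->; rewrite size_take; case: ltnP => // /ltnW. Qed.

Definition move_to x (c : 'I_d) (a : 'I_n) : point :=
  [ffun c' => if c' == c then a else x c'].

Lemma adjacent_move_to x c (a : 'I_n) :
  (x c = a.+1 :> nat \/ a = (x c).+1 :> nat) -> adjacent x (move_to x c a).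
Proof.
move=> xa; apply/eqP; rewrite /l1_dist (bigD1 c) //= ffunE eqxx big1 ?addn0.
  by case: xa => ->; lia.
by move=> i /negbTE ic; rewrite ffunE ic distnn.
Qed.

Lemma weight_move_to x c (a : 'I_n) : (weight (move_to x c a) + x c = weight x + a)%N.
Proof.
rewrite /weight (bigD1 c) //= [in RHS](bigD1 c) //= ffunE eqxx.
set s1 := (X in (_ + X + _)%N); set s2 := (X in (_ = _ + X + _)%N).
have -> : s1 = s2 by apply: eq_bigr => i /negbTE ic; rewrite ffunE ic.
by rewrite -addnA addnC -addnA addnCA addnA.
Qed.

(** Before the end of the path the next vertex is lower; off the path, lowering a positive
    coordinate decreases the value. The bounds on the counts keep the next vertex in the grid. *)
Lemma local_min_path w x : (forall c, count_mem c w < n)%N ->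
  local_min (path_fun w) x -> ends_at w x.
Proof.
move=> wn xmin; have [xw|xw] := boolP (on_path w x).
  have := on_path_weight xw; rewrite leq_eqVlt => /orP[/eqP ws|ws].
    by move: xw; rewrite /on_path ws take_size.
  have c0 : 'I_d by case: (w) ws.
  pose c := nth c0 w (weight x).
  have tw : take (weight x).+1 w = rcons (take (weight x) w) c by rewrite (take_nth c0).
  have xc c' : x c' = count_mem c' (take (weight x) w) :> nat.
    exact/eqP/(forallP xw).
  have cn : ((x c).+1 < n)%N.
    apply: leq_ltn_trans (wn c); rewrite -(cat_take_drop (weight x).+1 w) count_cat tw.
    by rewrite -cats1 count_cat -xc /= eqxx; lia.
  pose y := move_to x c (Ordinal cn).
  have wy : weight y = (weight x).+1
    by have := weight_move_to x c (Ordinal cn); rewrite -/y /=; lia.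
  have yw : on_path w y.
    apply/forallP => c'; rewrite wy tw -cats1 count_cat -xc ffunE /= addn0 (eq_sym c c').
    by have [->|cc] := eqVneq c' c; rewrite /= ?addn1 ?addn0.
  have /xmin : adjacent x y by apply: adjacent_move_to; right.
  by rewrite /path_fun xw yw wy lerN2 ler_nat ltnn.
(* The origin lies on every path, so a point off the path has a positive coordinate. *)
have [c xc] : exists c, (0 < x c)%N.
  apply/existsP; apply: contraNT xw; rewrite negb_exists => /forallP x0.
  apply/forallP => c; have w0 : weight x = 0%N.
    by rewrite /weight big1 // => i _; apply/eqP; rewrite -leqn0 leqNgt.
  by rewrite w0 take0 /= -leqn0 leqNgt.
have cn : ((x c).-1 < n)%N by rewrite (leq_ltn_trans (leq_pred _)).
pose y := move_to x c (Ordinal cn).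
have wy : weight x = (weight y).+1
    by have := weight_move_to x c (Ordinal cn); rewrite -/y /=; lia.
have /xmin : adjacent x y by apply: adjacent_move_to; left; rewrite /= prednK.
have : path_fun w y <= (weight y)%:R.
  by rewrite /path_fun; case: ifP => // _; rewrite ge0_cp // ?ler0n.
rewrite {2}/path_fun (negbTE xw) wy => h1 h2.
by have := le_trans h2 h1; rewrite ler_nat ltnn.
Qed.

(* [x] is a vertex, after the end of [u], of the path [u ++ v]. *)
Definition revealed u v x : bool :=
  [exists t : 'I_(size v), ends_at (u ++ take t.+1 v) x].

Lemma revealed_catl u v v' x : revealed u v x -> revealed u (v ++ v') x.
Proof.
move=> /existsP[t e]; have tv : (t < size (v ++ v'))%N.
  by rewrite size_cat ltn_addr.
apply/existsP; exists (Ordinal tv); rewrite /= take_cat.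
case: ltnP => // vt; have tE : t.+1 = size v by have := ltn_ord t; lia.
by move: e; rewrite tE subnn take0 cats0 take_size.
Qed.

(** Up to the weight of the end of [u] the paths agree; beyond it only the longer one has vertices,
    and these are the revealed ones. *)
Lemma path_fun_cat u v x : ~~ revealed u v x -> path_fun (u ++ v) x = path_fun u x.
Proof.
move=> r; rewrite /path_fun; suff -> : on_path (u ++ v) x = on_path u x by [].
rewrite /on_path take_cat; case: ltnP => // ux; rewrite (take_oversize ux).
have [->|ux'] := eqVneq (weight x) (size u); first by rewrite subnn take0 cats0.
have -> : ends_at u x = false by apply/negP => /ends_at_weight /eqP; rewrite (negbTE ux').
apply/negP => e; have := ends_at_weight e; rewrite size_cat size_take.
move: r; rewrite negb_exists => /forallP r h.
have tv : ((weight x - size u).-1 < size v)%N by move: h; case: ltnP; lia.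
have := r (Ordinal tv); rewrite /= prednK ?e //; lia.
Qed.
End PathFunctions.

(** * Runs of an algorithm on inputs agreeing on the queried points *)

Section Rounds.
Variables (R : realType) (d n : nat).
Local Notation point := (grid d n).

Fixpoint round_queries k (A : algorithm R d n k) (f : point -> R) (j : nat)
    : {set point} :=
  match A with
  | Output _ => finset.set0
  | Round _ Q next =>
    if j is j'.+1 then round_queries (next [ffun x => f (val x)]) f j' else Q
  end.

Lemma card_round_queries k (A : algorithm R d n k) f j :
  (#|round_queries A f j| <= num_queries A f)%N.
Proof.
elim: A j => [x|k' Q next IH] j /=; first by rewrite cards0.
by case: j => [|j]; rewrite ?leq_addr // (leq_trans (IH _ j)) // leq_addl.
Qed.

(* Whether round j sees a difference is tested on the run against [g j], not
   against [f]: this makes the j-th query set independent of the part of [f]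
   that is random given [g j]. *)
Lemma output_agree k (A : algorithm R d n k) (f : point -> R) (g : nat -> point -> R) :
  (forall j i x, (j < k)%N -> (j < i <= k)%N ->
     x \in round_queries A (g j) j -> g i x = f x) ->
  output A f = output A (g k).
Proof.
elim: A g => [x|k' Q next IH] g agree //=.
have aE i : (0 < i <= k'.+1)%N ->
    [ffun x : {x | x \in Q} => g i (val x)] = [ffun x => f (val x)].
  by move=> i0; apply/ffunP => x; rewrite !ffunE; apply: (agree 0%N); rewrite ?(valP x).
rewrite (aE k'.+1) ?ltnSn ?leqnn // (IH _ (fun j => g j.+1)) // => j i x jk ji xQ.
by apply: (agree j.+1 i.+1 x jk ji); rewrite /= aE //= ltnW.
Qed.
End Rounds.

(** * Random displacements *)

Section Averaging.
Variables (R : realType) (d n K : nat).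
Local Notation point := (grid d n).
Local Notation displacements := {ffun 'I_K -> point}.
Implicit Types (D : 'I_K -> {set point}) (s : seq 'I_K) (u : displacements).

(** A displacement is walked axis by axis; later arguments use only the number of steps per axis. *)
Definition block (x : point) : seq 'I_d := flatten [seq nseq (x c) c | c <- enum 'I_d].

Definition word s u : seq 'I_d := flatten [seq block (u i) | i <- s].

Lemma count_block c x : count_mem c (block x) = x c.
Proof.
rewrite count_flatten -map_comp sumnE big_map big_enum /= (bigD1 c) //=.
rewrite count_nseq /= eqxx mul1n big1 ?addn0 // => i /negbTE ic.
by rewrite count_nseq /= ic.
Qed.

Lemma size_block x : size (block x) = weight x.
Proof. by rewrite -sum_count_mem; apply: eq_bigr => c _; rewrite count_block. Qed.

Lemma count_word c s u : count_mem c (word s u) = (\sum_(i <- s) u i c)%N.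
Proof.
rewrite count_flatten -map_comp sumnE big_map.
by apply: eq_bigr => i _; rewrite /= count_block.
Qed.

Lemma size_word s u : size (word s u) = (\sum_(i <- s) weight (u i))%N.
Proof.
rewrite size_flatten /shape -map_comp sumnE big_map.
by apply: eq_bigr => i _; rewrite /= size_block.
Qed.

Definition resample u (j : 'I_K) (x : point) : displacements :=
  [ffun i => if i == j then x else u i].

Lemma word_resample s u j x : j \notin s -> word s (resample u j x) = word s u.
Proof.
move=> js; rewrite /word; congr flatten; apply/eq_in_map => i si.
by rewrite ffunE; case: eqP => // ij; move: js; rewrite -ij si.
Qed.

(* Swapping the j-th displacement with the fresh one is an involution. *)
Lemma sum_resample D (j : 'I_K) (h : displacements -> nat) :
  (\sum_(u in family (fun i => mem (D i))) \sum_(x in D j) h (resample u j x) =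
   #|D j| * \sum_(u in family (fun i => mem (D i))) h u)%N.
Proof.
transitivity (\sum_(u in family (fun i => mem (D i))) \sum_(x in D j) h u)%N.
  rewrite !pair_big /=.
  pose phi (p : displacements * point) := (resample p.1 j p.2, p.1 j).
  have phiK : involutive phi.
    move=> [u x]; rewrite /phi /=; congr (_, _); last by rewrite ffunE eqxx.
    by apply/ffunP => i; rewrite !ffunE; case: eqP => // ->.
  rewrite [RHS](reindex_inj (inv_inj phiK)) /=; apply: eq_bigl => -[u x] /=.
  apply/andP/andP => -[/familyP uD xD]; split => //.
  - by apply/familyP => i; rewrite ffunE; case: eqP => [->|_].
  - by apply/familyP => i; have := uD i; rewrite ffunE; case: eqP => // -> _.
  - by have := uD j; rewrite ffunE eqxx.
by rewrite big_distrr; apply: eq_bigr => u _ /=; rewrite sum_nat_const.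
Qed.

Definition before (j : nat) : seq 'I_K := take j (enum 'I_K).
Definition following (j : nat) : seq 'I_K := drop j (enum 'I_K).

Lemma before_ord (j : 'I_K) : before j.+1 = rcons (before j) j.
Proof.
by rewrite /before (take_nth j) ?size_enum_ord // nth_ord_enum.
Qed.

Lemma mem_before (j : nat) i : i \in before j = (i < j)%N.
Proof.
rewrite /before -(mem_map val_inj) map_take val_enum_ord take_iota mem_iota /=.
by have := ltn_ord i; lia.
Qed.

Lemma mem_following (j : nat) i : i \in following j = (j <= i)%N.
Proof.
rewrite /following -(mem_map val_inj) map_drop val_enum_ord drop_iota mem_iota /=.
by have := ltn_ord i; lia.
Qed.

Lemma word_split j u : word (before j) u ++ word (following j) u = word (enum 'I_K) u.
Proof. by rewrite /word -flatten_cat -map_cat cat_take_drop. Qed.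

Lemma word_before (j : 'I_K) u :
  word (before j.+1) u = word (before j) u ++ block (u j).
Proof. by rewrite before_ord /word map_rcons flatten_rcons. Qed.

(** The endpoint is the sum of the three displacements, so with [v] and [w] fixed it determines the
    middle one. *)
Lemma ends_at_cat_block_inj v w (y x x' : point) :
  ends_at (v ++ block x ++ w) y -> ends_at (v ++ block x' ++ w) y -> x = x'.
Proof.
move=> /forallP e /forallP e'; apply/ffunP => c; apply: val_inj => /=.
have /eqP := e c; have /eqP := e' c; rewrite !count_cat !count_block; lia.
Qed.

Lemma card_sub1 (P : pred point) : {in P &, forall x y, x = y} -> (#|P| <= 1)%N.
Proof.
move=> h; rewrite leqNgt; apply/card_gt1P => -[x [y [/h xP /xP -> ]]].
by rewrite eqxx.
Qed.

Variables (k : nat) (A : algorithm R d n k).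

(* [j] counts from 0: the input truncated before its segment number [j]. *)
Definition staged_fun j u : point -> R := path_fun R (word (before j) u).

(** The vertices of segment [j] itself are conceded to round [j]; only those past its end count. *)
Definition hits j u : bool :=
  [exists x in round_queries A (staged_fun j u) j,
     revealed (word (before j.+1) u) (word (following j.+1) u) x].

(** Resampling the [j]-th displacement changes neither the queries of round [j] nor the later
    segments. For each query and each of the at most [s] later vertices, at most one displacement
    makes them coincide. *)
Lemma sum_hits D (s : nat) (j : 'I_K) :
  (forall u, u \in family (fun i => mem (D i)) ->
     size (word (following j.+1) u) <= s)%N ->
  (#|D j| * \sum_(u in family (fun i => mem (D i))) hits j u <=
   s * \sum_(u in family (fun i => mem (D i))) num_queries A (staged_fun j u))%N.
Proof.
move=> us; rewrite -sum_resample big_distrr /=; apply: leq_sum => u /us {}us.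
have wb x : word (before j) (resample u j x) = word (before j) u.
  by rewrite word_resample // mem_before ltnn.
have wf x : word (following j.+1) (resample u j x) = word (following j.+1) u.
  by rewrite word_resample // mem_following ltnn.
set Q := round_queries A (staged_fun j u) j; set v := word (before j) u.
set w := word (following j.+1) u.
have hE x : (hits j (resample u j x) <= \sum_(y in Q) \sum_(t < size w)
     ends_at (v ++ block x ++ take t.+1 w) y)%N.
  rewrite /hits /staged_fun wb wf word_before wb ffunE eqxx.
  case: existsP => // -[y /andP[yQ /existsP[t e]]].
  by rewrite (bigD1 y) //= (bigD1 t) //= catA e.
apply: (@leq_trans (\sum_(x in D j) \sum_(y in Q) \sum_(t < size w)
     ends_at (v ++ block x ++ take t.+1 w) y)%N); first exact: leq_sum.
rewrite exchange_big /=; apply: (@leq_trans (\sum_(y in Q) s)%N); last first.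
  by rewrite sum_nat_const mulnC leq_mul2l card_round_queries orbT.
apply: leq_sum => y _; rewrite exchange_big /=; apply: leq_trans us.
rewrite -[leqRHS]card_ord -[leqRHS]sum1_card; apply: leq_sum => t _.
rewrite -big_mkcondr /= sum1_card.
by apply: card_sub1 => x x' /andP[_ e] /andP[_ e']; exact: ends_at_cat_block_inj e e'.
Qed.
End Averaging.

(** * Success of a deterministic algorithm on random paths *)

Section HardInputs.
Variables (R : realType) (d n k : nat) (m : nat -> nat).
Local Notation point := (grid d n).
Local Notation displacements := {ffun 'I_k.+1 -> point}.

Definition full_word (u : displacements) : seq 'I_d := word (enum 'I_k.+1) u.

Definition small (j : nat) : {set point} := [set x : point | [forall c, x c < m j]%N].

Definition small_displacements : pred displacements :=
  [pred u | u \in family (fun i : 'I_k.+1 => mem (small i))].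

Definition remaining (j : nat) : nat := (\sum_(i < k.+1 | j < i) d * m i)%N.

Lemma card_small j : (m j <= n)%N -> #|small j| = (m j ^ d)%N.
Proof.
move=> mn; rewrite /small cardsE (card_box (fun _ => [pred v : 'I_n | v < m j]%N)).
rewrite prod_nat_const card_ord; congr (_ ^ _)%N.
by rewrite -sum1_card (big_ord_narrow mn) sum1_card card_ord.
Qed.

Lemma size_following u (j : nat) : u \in small_displacements ->
  (size (word (following k.+1 j.+1) u) <= remaining j)%N.
Proof.
move=> /familyP uD; rewrite size_word big_uniq; last by rewrite drop_uniq ?enum_uniq.
rewrite (eq_bigl (fun i : 'I_k.+1 => j < i)%N) => [|i]; last by rewrite mem_following.
apply: leq_sum => i _; have := uD i; rewrite inE => /forallP ui.
apply: leq_trans (_ : \sum_(c < d) m i <= _)%N.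
  by apply: leq_sum => c _; exact: ltnW.
by rewrite sum_nat_const card_ord.
Qed.

Lemma count_full_word u c : (forall i : 'I_k.+1, (0 < m i)%N) ->
  (\sum_(i < k.+1) (m i).-1 < n)%N -> u \in small_displacements ->
  (count_mem c (full_word u) < n)%N.
Proof.
move=> m0 mn /familyP uD; apply: leq_ltn_trans mn; rewrite count_word big_enum /=.
apply: leq_sum => i _; have := uD i; rewrite inE => /forallP /(_ c).
by move=> uic; rewrite -ltnS (ltn_predK (m0 i)).
Qed.

Variable A : algorithm R d n k.

Definition success u : bool := ends_at (full_word u) (output A (path_fun R (full_word u))).

Definition guess u : bool := ends_at (full_word u) (output A (staged_fun R k u)).

(** Without a hit no round sees a vertex past its own segment, so the run ends as on the path
    lacking segment [k], and success becomes a guess. *)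
Lemma success_le u : (success u <= \sum_(j < k) hits A j u + guess u)%N.
Proof.
have [/existsP[j hj]|] := boolP [exists j : 'I_k, hits A j u].
  by rewrite (bigD1 j) //= hj; case: (success u).
rewrite negb_exists => /forallP nohit; rewrite -[leqLHS]add0n leq_add //.
rewrite /success /guess (@output_agree _ _ _ _ _ _ (fun j => staged_fun R j u)) //.
move=> j i x jk /andP[ji ik] xQ; have := nohit (Ordinal jk).
rewrite /hits negb_exists => /forallP /(_ x); rewrite xQ /= => nrev.
rewrite /staged_fun /full_word -(word_split j.+1) path_fun_cat //.
(* Stage [i] prolongs stage [j.+1] by an initial part of the remaining segments, which the queries
   of round [j] miss as well. *)
have -> : before k.+1 i = before k.+1 j.+1 ++ take (i - j.+1) (following k.+1 j.+1).
  by rewrite /before /following -takeD subnKC.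
rewrite /word map_cat flatten_cat path_fun_cat //.
apply: contra nrev => r; rewrite -(cat_take_drop (i - j.+1) (following k.+1 j.+1)).
by rewrite /word map_cat flatten_cat revealed_catl.
Qed.

(** The guessed point does not depend on the last displacement, and at most one value of it makes
    the path end there. *)
Lemma sum_guess :
  (#|small k| * \sum_(u in small_displacements) guess u <= #|small_displacements|)%N.
Proof.
rewrite -(sum_resample (fun i : 'I_k.+1 => small i) ord_max) -sum1_card.
apply: leq_sum => u _.
have wb x : staged_fun R k (resample u ord_max x) = staged_fun R k u.
  by rewrite /staged_fun word_resample // mem_before ltnn.
rewrite -big_mkcondr /= sum1_card; apply: card_sub1 => x x' /andP[_ +] /andP[_].
rewrite /guess !wb.
rewrite /full_word -!(word_split k.+1) !(word_before ord_max) !word_resample.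
  rewrite !ffunE eqxx -!catA => e e'; exact: ends_at_cat_block_inj e e'.
all: by rewrite ?mem_before ?mem_following ltnn.
Qed.

Lemma sum_success : (forall j : 'I_k.+1, (0 < m j <= n)%N) ->
  \sum_(u in small_displacements) (success u)%:R <=
  \sum_(j < k) \sum_(u in small_displacements)
     ((remaining j)%:R / (m j ^ d)%:R) * (num_queries A (staged_fun R j u))%:R
  + #|small_displacements|%:R / (m k ^ d)%:R :> R.
Proof.
move=> mn; set S := small_displacements.
have mjn (j : 'I_k.+1) : (m j <= n)%N by have /andP[] := mn j.
have md0 (j : 'I_k.+1) : 0 < (m j ^ d)%:R :> R.
  by rewrite ltr0n expn_gt0; have /andP[->] := mn j.
apply: (@le_trans _ _ (\sum_(u in S) (\sum_(j < k) (hits A j u)%:R + (guess u)%:R))).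
  by apply: ler_sum => u _; rewrite -natr_sum -natrD ler_nat success_le.
rewrite big_split /= lerD //; last first.
  rewrite ler_pdivlMr ?(md0 ord_max) // -natr_sum -natrM ler_nat mulnC.
  by rewrite -(card_small (mjn ord_max)) sum_guess.
rewrite exchange_big /=; apply: ler_sum => j _.
pose j' : 'I_k.+1 := widen_ord (leqnSn k) j.
rewrite -mulr_sumr mulrAC ler_pdivlMr ?(md0 j') // -!natr_sum -!natrM ler_nat mulnC.
rewrite -(card_small (mjn j')).
by apply: (@sum_hits _ _ _ _ _ A (fun i : 'I_k.+1 => small i) _ j') => u; exact: size_following.
Qed.
End HardInputs.

Local Open Scope classical_set_scope.

(** * Lower bound for a fixed displacement scale *)

Section WeightedExpectation.
Context {disp : measure_display} {T : measurableType disp} {R : realType}.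
Variable P : probability T R.
Local Open Scope ereal_scope.

(** Averaging over the coins: [X] will be the success indicators on the hard inputs, [Y] the query
    counts on the truncated ones, and [y] their common cost bound. *)
Lemma expectation_weighted_bound (I J : eqType) (r : seq I) (s : seq J)
    (X : I -> T -> R) (Y : J -> T -> R) (a : J -> R) (b x y : R) :
  (forall i, measurable_fun [set: T] (X i)) -> (forall j, measurable_fun [set: T] (Y j)) ->
  (forall i w, 0 <= X i w)%R -> (forall j w, 0 <= Y j w)%R ->
  (forall j, 0 <= a j)%R -> (0 <= b)%R ->
  (forall w, \sum_(i <- r) X i w <= \sum_(j <- s) a j * Y j w + b)%R ->
  (forall i, i \in r -> x%:E <= \int[P]_w (X i w)%:E) ->
  (forall j, j \in s -> \int[P]_w (Y j w)%:E <= y%:E) ->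
  (\sum_(i <- r) x <= \sum_(j <- s) a j * y + b)%R.
Proof.
move=> mX mY X0 Y0 a0 b0 XY xX Yy; rewrite -lee_fin EFinD -!sumEFin.
have mX' i : measurable_fun [set: T] (EFin \o X i) by exact/measurable_EFinP.
have maY j : measurable_fun [set: T] (EFin \o (fun w => a j * Y j w)%R).
  by apply/measurable_EFinP; exact: measurable_funM.
have aY0 j w : 0 <= (a j * Y j w)%:E by rewrite lee_fin mulr_ge0.
apply: (@le_trans _ _ (\sum_(i <- r) \int[P]_w (X i w)%:E)).
  by rewrite big_seq [leRHS]big_seq; exact: lee_sum.
rewrite -ge0_integral_sum //; last by move=> i w _; rewrite lee_fin.
apply: (@le_trans _ _ (\int[P]_w (\sum_(j <- s) (a j * Y j w)%:E + b%:E))).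
  apply: ge0_le_integral => //.
  - by move=> w _; apply: sume_ge0 => i _; rewrite lee_fin.
  - exact: emeasurable_sum.
  - by apply: emeasurable_funD => //; exact: emeasurable_sum.
  - by move=> w _; rewrite !sumEFin -EFinD lee_fin.
rewrite ge0_integralD //.
- rewrite integral_cst //= probability_setT mule1 leeD2r //.
  rewrite ge0_integral_sum // [leLHS]big_seq [leRHS]big_seq; apply: lee_sum => j js.
  under eq_integral do rewrite EFinM.
  rewrite ge0_integralZl //; last 2 first.
  - by move=> w _; rewrite lee_fin.
  - by rewrite lee_fin.
  by rewrite EFinM lee_wpmul2l ?lee_fin // Yy.
  - exact/measurable_EFinP.
- by move=> w _; apply: sume_ge0.
- exact: emeasurable_sum.
Qed.
End WeightedExpectation.

Section LowerBound.
Variables (R : realType) (d n k : nat) (m : nat -> nat).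
Local Notation point := (grid d n).

(** The grid is finite, so the event is a finite union of events with a prescribed output. *)
Lemma measurable_output_pred (A : randomized_algorithm R d n k) (f : point -> R)
  (Q : point -> Prop) : measurable [set w : coins A | Q (output (play w) f)].
Proof.
rewrite (_ : mkset _ = \bigcup_(x in Q) [set w : coins A | output (play w) f = x]).
  apply: fin_bigcup_measurable; first exact: finite_finset.
  by move=> x _; exact: measurable_output.
by apply/seteqP; split => w /= => [Qw|[x Qx ->//]]; exists (output (play w) f).
Qed.

Lemma randomized_lower_bound (A : randomized_algorithm R d n k) (t : R) :
  randomized_correct A -> (forall f, expected_queries A f <= t%:E)%E ->
  (forall j : 'I_k.+1, (0 < m j <= n)%N) -> (\sum_(i < k.+1) (m i).-1 < n)%N ->
  2 / 3 <= t * \sum_(j < k) (remaining d k m j)%:R / (m j ^ d)%:R + (m k ^ d)%:R^-1.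
Proof.
move=> corr At mn mn'; set S := @small_displacements d n k m.
have m0 (i : 'I_k.+1) : (0 < m i)%N by have /andP[] := mn i.
pose N : R := #|S|%:R.
have N0 : 0 < N.
  rewrite ltr0n; apply/card_gt0P.
  have n0 : (0 < n)%N by rewrite (leq_ltn_trans _ mn').
  exists [ffun=> [ffun=> Ordinal n0]]; apply/familyP => i.
  by rewrite ffunE inE; apply/forallP => c; rewrite ffunE m0.
pose a (p : 'I_k * {ffun 'I_k.+1 -> point}) : R :=
  (remaining d k m p.1)%:R / (m p.1 ^ d)%:R.
have a0 p : 0 <= a p by rewrite divr_ge0.
have pairE (F : 'I_k * {ffun 'I_k.+1 -> point} -> R) :
    \sum_(p <- [seq (j, u) | j <- enum 'I_k, u <- enum S]) F p =
    \sum_(j < k) \sum_(u in S) F (j, u).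
  by rewrite big_allpairs big_enum /=; apply: eq_bigr => j _; rewrite big_enum.
have := @expectation_weighted_bound _ _ _ (coins_law A)
  {ffun 'I_k.+1 -> point} ('I_k * {ffun 'I_k.+1 -> point})%type (enum S)
  [seq (j, u) | j <- enum 'I_k, u <- enum S]
  (fun u (w : coins A) => (success (play w) u)%:R)
  (fun p (w : coins A) => (num_queries (play w) (staged_fun R p.1 p.2))%:R)
  a (N / (m k ^ d)%:R) (2 / 3) t.
rewrite pairE /a /=.
(* The cost bound [t] is the same for all displacements, so summing over them gives a factor [N],
   which then cancels. *)
have -> : \sum_(j < k) \sum_(u in S) (remaining d k m j)%:R / (m j ^ d)%:R * t =
    (t * \sum_(j < k) (remaining d k m j)%:R / (m j ^ d)%:R) * N :> R.
  rewrite mulr_sumr mulr_suml; apply: eq_bigr => j _.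
  by rewrite sumr_const -[_ *+ #|S|]mulr_natr -/N (mulrC t).
rewrite big_enum sumr_const -[_ *+ #|S|]mulr_natr -/N (mulrC N) -mulrDl ler_pM2r //.
have mS u : measurable_fun [set: coins A] (fun w : coins A => (success (play w) u)%:R : R).
  rewrite (_ : (fun w : coins A => _) =
      \1_[set w : coins A | ends_at (full_word u) (output (play w)
      (path_fun R (full_word u)))]).
    apply: measurable_indic.
    exact: (measurable_output_pred A _ (fun x => ends_at (full_word u) x)).
  apply/funext => w; rewrite indicE /success; congr (nat_of_bool _)%:R.
  by apply/idP/idP; rewrite inE.
apply => //.
- move=> p; apply: (@measurableT_comp _ _ _ _ _ _ (fun q : nat => q%:R : R)).
    by move=> _ Y _; rewrite setTI.
  exact: measurable_num_queries.
- by rewrite mulr_ge0 ?invr_ge0 // ltW.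
- by move=> w; rewrite pairE big_enum [X in _ + X]mulrC; exact: sum_success.
- move=> u; rewrite mem_enum => uS.
  (* A local minimum must be the end of the path, so success is at least as likely as
     correctness. *)
  apply: (le_trans (corr (path_fun R (full_word u)))).
  have -> : (\int[coins_law A]_w ((success (play w) u)%:R)%:E =
      coins_law A [set w : coins A | success (play w) u])%E.
    rewrite -[[set w | _]]setIT -integral_indic //; last first.
      exact: (measurable_output_pred A _ (fun x => ends_at (full_word u) x)).
    by apply: eq_integral => w _; rewrite indicE /= mem_setE.
  apply: le_measure; rewrite ?inE.
  - exact: (measurable_output_pred A _ (local_min _)).
  - exact: (measurable_output_pred A _ (fun x => ends_at (full_word u) x)).
  - move=> w /=; apply: local_min_path => c; exact: count_full_word uS.
- by move=> [j u] _; have := At (staged_fun R j u); rewrite /expected_queries unlock.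
Qed.
End LowerBound.

(** * Choice of the scales *)

Section Scales.
Variables (R : realType) (d k : nat).
Hypotheses (d2 : (2 <= d)%N) (k1 : (1 <= k)%N).

Definition scale_exponent (i : nat) : R := (d%:R ^+ k - d%:R ^+ i) / (d%:R ^+ k - 1).

Definition rate_exponent : R := (d%:R ^+ k.+1 - d%:R ^+ k) / (d%:R ^+ k - 1).

Definition scale (n i : nat) : R := n%:R `^ scale_exponent i.

Let dk : 0 < d%:R ^+ k - 1 :> R.
Proof. by rewrite subr_gt0 exprn_egt1 ?ltr1n // -lt0n. Qed.

Lemma scale_exponent_anti i j : (i <= j)%N -> scale_exponent j <= scale_exponent i.
Proof.
move=> ij; rewrite /scale_exponent ler_pM2r ?invr_gt0 // lerD2l lerN2.
by rewrite ler_weXn2l // ler1n ltnW.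
Qed.

Lemma scale0 n : scale n 0 = n%:R.
Proof. by rewrite /scale /scale_exponent expr0 divff ?gt_eqF // powRr1. Qed.

Lemma scale_last n : scale n k = 1.
Proof. by rewrite /scale /scale_exponent subrr mul0r powRr0. Qed.

Lemma scale_anti n i j : (0 < n)%N -> (i <= j)%N -> scale n j <= scale n i.
Proof. by move=> n0 ij; rewrite ler_powR ?ler1n // scale_exponent_anti. Qed.

Lemma scale_ge1 n i : (0 < n)%N -> (i <= k)%N -> 1 <= scale n i.
Proof. by move=> n0 ik; rewrite -(scale_last n) scale_anti. Qed.

(** The exponents are chosen for this: d(d^k - d^i) = (d^(k+1) - d^k) + (d^k - d^(i+1)). It balances
    the rounds in both bounds. *)
Lemma scaleX n i : (0 < n)%N -> scale n i ^+ d = n%:R `^ rate_exponent * scale n i.+1.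
Proof.
move=> n0; rewrite /scale -powR_mulrn ?powR_ge0 // -powRrM -powRD; last first.
  by rewrite pnatr_eq0 -lt0n n0 implybT.
congr (_ `^ _); rewrite /scale_exponent /rate_exponent -mulrDl mulrAC; congr (_ / _).
by rewrite !exprS; ring.
Qed.

Lemma rate_ge1 n : (0 < n)%N -> 1 <= n%:R `^ rate_exponent :> R.
Proof.
move=> n0; rewrite -[leLHS](powRr0 n%:R) ler_powR ?ler1n // divr_ge0 ?ltW // subr_gt0.
by rewrite ltr_eXn2l ?ltr1n.
Qed.

(* Here [j] counts the remaining rounds, hence the index [k - j]. *)
Definition cell_size (n j : nat) : nat :=
  if j is 0 then 1%N else (Num.trunc (scale n (k - j))).+1.

Lemma cell_size_ge n j : scale n (k - j) <= (cell_size n j)%:R.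
Proof.
case: j => [|j]; first by rewrite subn0 scale_last.
by have /andP[_ /ltW] := truncn_itv (powR_ge0 n%:R (scale_exponent (k - j.+1))).
Qed.

(** Rounding up at most doubles a scale, since scales are at least 1. *)
Lemma cell_size_le n j : (0 < n)%N -> (cell_size n j)%:R <= 2 * scale n (k - j).
Proof.
move=> n0; have M1 : 1 <= scale n (k - j) by rewrite scale_ge1 ?leq_subr.
case: j M1 => [|j] M1 /=; first by rewrite subn0 scale_last mulr1 ler1n.
have /andP[+ _] := truncn_itv (powR_ge0 n%:R (scale_exponent (k - j.+1))).
by rewrite -/(scale _ _) -natr1; lra.
Qed.

Lemma cell_size_mono n j : (0 < n)%N -> (cell_size n j <= cell_size n j.+1)%N.
Proof.
by case: j => [|j] n0 //=; rewrite ltnS le_truncn // scale_anti // leq_sub2l.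
Qed.

(** The main term is of order l_(k-j-1)^d / l_(k-j), which [scaleX] identifies with the rate;
    rounding and the doubled side give 4^d, and the extra query is paid by a rate of at least 1. *)
Lemma round_cost n j : (0 < n)%N -> (j < k)%N ->
  (d * ((2 * cell_size n j.+1 %/ cell_size n j + 2) * (2 * cell_size n j.+1) ^ d.-1) + 1)%:R
  <= (d%:R * 2 * 4 ^+ d + 1) * n%:R `^ rate_exponent :> R.
Proof.
move=> n0 jk; set x := cell_size n j.+1; set y := cell_size n j.
set N := n%:R `^ rate_exponent.
have xy : (y <= x)%N by exact: cell_size_mono.
have y0 : 0 < y%:R :> R by rewrite ltr0n /y; case: (j).
have M0 : 0 < scale n (k - j) by rewrite powR_gt0 // ltr0n.
rewrite natrD mulrDl lerD ?mul1r ?rate_ge1 // !natrM -!mulrA ler_wpM2l //.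
have step1 : (2 * x %/ y + 2)%:R <= 4 * x%:R / y%:R :> R.
  rewrite ler_pdivlMr // -!natrM ler_nat mulnDl.
  by have := leq_trunc_div (2 * x) y; lia.
apply: (@le_trans _ _ (4 * x%:R / y%:R * (2 * x)%:R ^+ d.-1)).
  by rewrite natrX ler_wpM2r // exprn_ge0.
have -> : 4 * x%:R / y%:R * (2 * x)%:R ^+ d.-1 = 2 * ((2 * x)%:R ^+ d / y%:R) :> R.
  by rewrite -[in RHS](ltn_predK d2) exprS natrM; lra.
rewrite ler_wpM2l // ler_pdivrMr //.
apply: (@le_trans _ _ ((4 * scale n (k - j.+1)) ^+ d)).
  rewrite lerXn2r ?nnegrE ?mulr_ge0 ?powR_ge0 // natrM.
  by have := cell_size_le j.+1 n0; rewrite -/x; lra.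
rewrite exprMn scaleX // -mulrA ler_wpM2l ?exprn_ge0 // ler_wpM2l ?powR_ge0 //.
by rewrite -subSn // subSS cell_size_ge.
Qed.

Lemma deterministic_upper_bound n : (0 < n)%N ->
  (deterministic_complexity R d k n <=
   (k%:R * (d%:R * 2 * 4 ^+ d + 1) * n%:R `^ rate_exponent)%:E)%E.
Proof.
move=> n0; pose p0 : grid d n := [ffun=> Ordinal n0].
pose A := descent R (cell_size n) k finset.setT p0.
have l0 j : (0 < cell_size n j)%N by case: j.
apply: (@le_trans _ _ (worst_case_queries A)).
  apply: ereal_inf_lbound; exists A => // f; apply: descent_correct => //.
  - by split=> [|x y]; rewrite ?inE.
  - by move=> k0; move: k1; rewrite k0.
apply: ge_ereal_sup => _ [f _ <-]; rewrite lee_fin.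
apply: (@le_trans _ _ (\sum_(j < k) (d * ((2 * cell_size n j.+1 %/ cell_size n j + 2)
    * (2 * cell_size n j.+1) ^ d.-1) + 1))%:R).
  rewrite ler_nat; apply: (num_queries_descent (s := fun j => 2 * cell_size n j)%N) => //.
  (* The first region is the whole grid, which fits because [cell_size n k] is at least [scale n 0],
     that is [n]. *)
  exists (fun=> 0%N) => x _ c; rewrite add0n /=; apply: leq_trans (ltn_ord _) _.
  rewrite -(ler_nat R); have := cell_size_ge n k; rewrite subnn scale0 natrM.
  by have : 0 <= (cell_size n k)%:R :> R by []; lra.
rewrite natr_sum; apply: (@le_trans _ _ (\sum_(j < k)
    (d%:R * 2 * 4 ^+ d + 1) * n%:R `^ rate_exponent)).
  by apply: ler_sum => j _; exact: round_cost.
by rewrite sumr_const card_ord -[_ *+ k]mulr_natl mulrA.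
Qed.

(** The division lets [k.+1] displacements fit into the grid together; the offset 2 leaves at least
    two values per coordinate even in the last one. *)
Definition displacement_size (n i : nat) : nat :=
  (Num.trunc (scale n i / (2 * k.+1)%:R)).+2.

Lemma displacement_size_ge n i :
  scale n i / (2 * k.+1)%:R <= (displacement_size n i)%:R.
Proof.
rewrite /displacement_size; set z := _ / _; have z0 : 0 <= z by rewrite divr_ge0 ?powR_ge0.
have /andP[_] := truncn_itv z0.
by rewrite -!natr1; lra.
Qed.

Lemma displacement_size_le n i :
  (displacement_size n i)%:R <= scale n i / (2 * k.+1)%:R + 2.
Proof.
rewrite /displacement_size; set z := _ / _; have z0 : 0 <= z by rewrite divr_ge0 ?powR_ge0.
have /andP[+ _] := truncn_itv z0.
by rewrite -!natr1; lra.
Qed.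

Definition gap_constant : R := k%:R * (3 * (k.+1)%:R * d%:R * (2 * k.+1)%:R ^+ d).

(** Each later size is at most [scale n j.+1] plus 2, hence at most three times that scale; the
    denominator is bounded below through [scaleX]. *)
Lemma remaining_ratio n j : (0 < n)%N -> (j < k)%N ->
  (remaining d k (displacement_size n) j)%:R / (displacement_size n j ^ d)%:R <=
  3 * (k.+1)%:R * d%:R * (2 * k.+1)%:R ^+ d / n%:R `^ rate_exponent :> R.
Proof.
move=> n0 jk; set q : R := (2 * k.+1)%:R; set N := n%:R `^ rate_exponent.
have q1 : 1 <= q by rewrite ler1n muln_gt0.
have q0 : 0 < q by lra.
have N0 : 0 < N by have := rate_ge1 n0; rewrite -/N; lra.
have M1 : 1 <= scale n j.+1 by rewrite scale_ge1.
rewrite ler_pdivrMr ?ltr0n ?expn_gt0 // mulrAC ler_pdivlMr //.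
apply: (@le_trans _ _ (3 * k.+1%:R * d%:R * scale n j.+1 * N)).
  rewrite ler_pM2r // /remaining natr_sum.
  apply: (@le_trans _ _ (\sum_(i < k.+1) d%:R * (3 * scale n j.+1))).
    rewrite big_mkcond /=; apply: ler_sum => i _; case: ifP => [ji|_]; last first.
      by rewrite !mulr_ge0 ?powR_ge0.
    rewrite natrM ler_wpM2l //; apply: le_trans (displacement_size_le n i) _.
    have Mij : scale n i <= scale n j.+1 by exact: scale_anti.
    have : scale n i / q <= scale n i by rewrite ler_pdivrMr // ler_peMr ?powR_ge0.
    by rewrite -/q; move: (scale n i / q) => z; move: (scale n i) Mij => Mi; lra.
  by rewrite sumr_const card_ord -[_ *+ k.+1]mulr_natr; lra.
rewrite -!mulrA !ler_wpM2l // (mulrC (scale _ _)) -scaleX // natrX -exprMn.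
rewrite lerXn2r ?nnegrE ?mulr_ge0 ?powR_ge0 ?(ltW q0) //.
by rewrite [leRHS]mulrC -ler_pdivrMr // displacement_size_ge.
Qed.

(** The sum is at most n/2 + k + 1, which explains the threshold on [n]. *)
Lemma displacement_sizes_sum n : (2 * k.+1 < n)%N ->
  (\sum_(i < k.+1) (displacement_size n i).-1 < n)%N.
Proof.
move=> kn; have n0 : (0 < n)%N by exact: leq_ltn_trans kn.
have kn' : (2 * k.+1)%:R < n%:R :> R by rewrite ltr_nat.
rewrite -(ltr_nat R) natr_sum.
apply: (@le_lt_trans _ _ (\sum_(i < k.+1) (n%:R / (2 * k.+1)%:R + 1))).
  apply: ler_sum => i _; rewrite -(lerD2r 1) natr1 /=.
  apply: le_trans (displacement_size_le n i) _; rewrite -addrA lerD2r.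
  by rewrite ler_pM2r ?invr_gt0 ?ltr0n // -[leRHS]scale0 scale_anti.
rewrite sumr_const card_ord -[_ *+ k.+1]mulr_natr mulrDl mul1r.
have -> : n%:R / (2 * k.+1)%:R * k.+1%:R = n%:R / 2 :> R.
  by rewrite natrM; field; rewrite addrC natr1 pnatr_eq0.
move: kn'; rewrite natrM; move: (n%:R : R) (k.+1%:R : R) => x y; lra.
Qed.

Lemma displacement_size_last n : displacement_size n k = 2%N.
Proof.
rewrite /displacement_size scale_last div1r; congr (_.+2).
apply: truncn_def; rewrite invr_ge0 ler0n /= invf_lt1 ?ltr0n // ltr1n; lia.
Qed.

(** A cheaper algorithm would give 2/3 <= 1/4 + 1/4: one quarter bounds the hits, the other the
    guess among 2^d >= 4 last displacements. *)
Lemma randomized_lower_rate n : (2 * k.+1 < n)%N ->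
  ((n%:R `^ rate_exponent / (4 * gap_constant))%:E <= randomized_complexity R d k n)%E.
Proof.
move=> kn; have n0 : (0 < n)%N by exact: leq_ltn_trans kn.
set N := n%:R `^ rate_exponent; set m := displacement_size n.
have N0 : 0 < N by have := rate_ge1 n0; rewrite -/N; lra.
have G0 : 0 < gap_constant by rewrite !mulr_gt0 ?exprn_gt0 ?ltr0n ?muln_gt0 // ltnW.
apply/ereal_infP => _ [A corr <-]; rewrite leNgt; apply/negP => lt.
have At f : (expected_queries A f <= (N / (4 * gap_constant))%:E)%E.
  by apply: le_trans (ltW lt); apply: ereal_sup_ubound; exists f.
have sm : (\sum_(i < k.+1) (m i).-1 < n)%N by exact: displacement_sizes_sum.
have mn (j : 'I_k.+1) : (0 < m j <= n)%N.
  by move: sm; rewrite (bigD1 j) //= /m /displacement_size /=; lia.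
have := randomized_lower_bound corr At mn sm.
have -> : m k = 2%N by exact: displacement_size_last.
have d4 : (2 ^ d)%:R^-1 <= 4^-1 :> R.
  by rewrite lef_pV2 ?posrE ?ltr0n ?expn_gt0 // ler_nat (@leq_pexp2l 2 2).
have sumN : \sum_(j < k) (remaining d k m j)%:R / (m j ^ d)%:R <= gap_constant / N :> R.
  apply: (@le_trans _ _ (\sum_(j < k)
     3 * (k.+1)%:R * d%:R * (2 * k.+1)%:R ^+ d / N)).
    by apply: ler_sum => j _; exact: remaining_ratio.
  by rewrite sumr_const card_ord -[_ *+ k]mulr_natl mulrA.
have : N / (4 * gap_constant) *
   (\sum_(j < k) (remaining d k m j)%:R / (m j ^ d)%:R) <= 4^-1.
  apply: (@le_trans _ _ (N / (4 * gap_constant) * (gap_constant / N))).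
    by rewrite ler_wpM2l // divr_ge0 ?(ltW N0) // mulr_ge0 // ltW.
  by rewrite le_eqVlt; apply/orP; left; apply/eqP; field; rewrite !gt_eqF.
lra.
Qed.
End Scales.

(** * From the two bounds to the asymptotic statements *)

Lemma randomized_le_deterministic (R : realType) (d k n : nat) :
  (randomized_complexity R d k n <= deterministic_complexity R d k n)%E.
Proof.
apply/ereal_infP => _ [A corr <-].
(* A deterministic algorithm is a randomized one whose coins have a single outcome. *)
pose B : randomized_algorithm R d n k := @RandomizedAlgorithm R d n k _ unit
  [the probability unit R of \d_tt] (fun=> A)
  (fun f => measurable_cst _) (fun f x => I).
apply: (@le_trans _ _ (worst_case_expected_queries B)).
  apply: ereal_inf_lbound; exists B => // f.
  rewrite /= (_ : mkset _ = setT); last by apply/seteqP; split => // w _; exact: corr.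
  by rewrite probability_setT lee_fin; lra.
apply: ge_ereal_sup => _ [f _ <-]; rewrite /expected_queries expectation_cst.
by apply: ereal_sup_ubound; exists f.
Qed.

(** [fine] sends infinite values to 0; the two-sided bound excludes them for large [n]. *)
Lemma is_bigTheta_fine (R : realType) (c : nat -> \bar R) (g : nat -> R) (a b : R) :
  0 < a -> 0 < b -> (forall n, 0 <= g n) ->
  (\forall n \near \oo, (a * g n)%:E <= c n /\ c n <= (b * g n)%:E)%E ->
  (fun n => fine (c n)) \is 'Theta_\oo(g).
Proof.
move=> a0 b0 g0 cg; rewrite qualifE; apply/asboolP; exists (a, b) => /=.
  by rewrite a0 b0.
near=> n; have [lo up] : ((a * g n)%:E <= c n /\ c n <= (b * g n)%:E)%E by near: n.
case: (c n) lo up => [r| |] //; rewrite !lee_fin /= => lo up.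
by rewrite (ger0_norm (g0 n)) ger0_norm // (le_trans _ lo) // mulr_ge0 // ltW.
Unshelve. all: by end_near. Qed.

Theorem theorem1 (R : realType) (d k : nat) (hd : (2 <= d)%N) (hk : (1 <= k)%N) :
  let rate (n : nat) : R :=
    n%:R `^ ((d%:R ^+ k.+1 - d%:R ^+ k) / (d%:R ^+ k - 1)) in
  (fun n : nat => fine (deterministic_complexity R d k n)) \is 'Theta_\oo(rate) /\
  (fun n : nat => fine (randomized_complexity R d k n)) \is 'Theta_\oo(rate).
Proof.
move=> rate; have G0 : 0 < (4 * gap_constant R d k)^-1.
  by rewrite invr_gt0 !mulr_gt0 ?exprn_gt0 ?ltr0n ?muln_gt0 // ltnW.
have C0 : 0 < k%:R * (d%:R * 2 * 4 ^+ d + 1) :> R.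
  by rewrite mulr_gt0 ?ltr0n // ltr_wpDl // !mulr_ge0.
have rate0 n : 0 <= rate n by exact: powR_ge0.
have lower n : (2 * k.+1 < n)%N ->
    (((4 * gap_constant R d k)^-1 * rate n)%:E <= randomized_complexity R d k n)%E.
  by move=> kn; rewrite mulrC; exact: randomized_lower_rate.
have upper n : (2 * k.+1 < n)%N -> (deterministic_complexity R d k n <=
    (k%:R * (d%:R * 2 * 4 ^+ d + 1) * rate n)%:E)%E.
  by move=> kn; apply: deterministic_upper_bound => //; exact: leq_ltn_trans kn.
(* This comparison lets the randomized lower bound and the deterministic upper bound serve both
   complexities. *)
have le n := randomized_le_deterministic R d k n.
split; apply: (is_bigTheta_fine G0 C0 rate0); near=> n.
- have kn : (2 * k.+1 < n)%N by near: n; exact: nbhs_infty_gt.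
  by split; [exact: le_trans (lower n kn) (le n)|exact: upper].
- have kn : (2 * k.+1 < n)%N by near: n; exact: nbhs_infty_gt.
  by split; [exact: lower|exact: le_trans (le n) (upper n kn)].
Unshelve. all: by end_near. Qed.
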